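(* Let $k$ be a field of characteristic $p>0$ such that $\mathbb{F}_q\subseteq k$ with $q=p^n$. Let $\vec\alpha\in W_m(k)$. If $K=k(\vec y_0)$ where $\vec y_0$ is a root of $\vec y^{\,q}-\vec y=\vec\alpha\in W_m(k)$, then $K/k$ is an abelian $p$-extension of exponent $p^h$ with $h\leq m$ and rank $l$ with $l\leq n$. Furthermore, if $G:=\operatorname{Gal}(K/k)$, then $G$ is isomorphic in a natural way to a subgroup of the Galois ring $W_m(\mathbb{F}_q)$. Conversely, if $K=k(\vec y_0)$ is an abelian $p$-extension of exponent $p^h$ and rank $l$, then $\vec y_0$ is a root of some equation of the form $\vec y^{\,q}-\vec y=\vec\alpha$ for some $\vec\alpha\in W_m(k)$.
   Context: Here $p$ is a prime and $m,n$ are positive integers. $W_m(R)$ denotes the ring of $p$-typical Witt vectors of length $m$ over a commutative ring $R$ with identity; $+$ and $-$ between Witt vectors denote the Witt operations. For $\vec x=(x_1,\ldots,x_m)$, $\vec x^{\,q}:=(x_1^q,\ldots,x_m^q)$ (componentwise power, not a power for Witt multiplication). Roots of $\vec y^{\,q}-\vec y=\vec\alpha$ are taken in $W_m(\bar k)$, where $\bar k$ is an algebraic closure of $k$. For $\vec y=(y_1,\ldots,y_m)$, $k(\vec y)$ means $k(y_1,\ldots,y_m)$, and $\sigma(\vec y)=(\sigma y_1,\ldots,\sigma y_m)$ for an automorphism $\sigma$. The natural map of $G$ into (the additive group of) $W_m(\mathbb{F}_q)$ sends $\sigma$ to the element $\vec\xi\in W_m(\mathbb{F}_q)$ with $\sigma(\vec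 y_0)=\vec y_0+\vec\xi$. The exponent and rank of an abelian $p$-extension are those of its Galois group; the rank of a finite abelian $p$-group is the number of nontrivial cyclic factors in its decomposition as a direct product of cyclic groups.
   Formalization: The converse is false for a given generator y_0 (m=n=1, p odd, z^p−z=a, y_0=z+z^2); it is stated instead as: every abelian p-extension K/k of exponent p^h, rank l, with h≤m and l≤n, equals k(y_0) for some y_0 that is a root of y^q−y=α with α in W_m(k). *)

(* Defs.v *)
From HB Require Import structures.
From mathcomp Require Import all_boot all_order all_fingroup all_algebra.
From mathcomp Require Import all_solvable all_field.
From mathcomp Require Import mpoly ring.

Set Implicit Arguments.
Unset Strict Implicit.
Unset Printing Implicit Defensive.

Import GRing.Theory Num.Theory.
Local Open Scope ring_scope.

Definition zeval (N : nat) (R : comNzRingType) (h : 'I_N -> R)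
  (P : {mpoly int[N]}) : R := mmap intr h P.

HB.instance Definition _ N (R : comNzRingType) (h : 'I_N -> R) :=
  GRing.RMorphism.copy (@zeval N R h) (mmap intr h).

Definition zeval2 (R : comNzRingType) (P : {mpoly int[2]}) (a b : R) : R :=
  zeval (tnth [tuple a; b]) P.

Section Zeval.
Variables (N : nat) (R S : comNzRingType).
Implicit Types (P Q : {mpoly int[N]}) (h : 'I_N -> R).

Lemma zevalX h m : zeval h 'X_[m] = mmap1 h m.
Proof. exact: mmapX. Qed.

Lemma zevalXU h i : zeval h 'X_i = h i.
Proof. by rewrite zevalX mmap1U. Qed.

Lemma eq_zeval h h' P : h =1 h' -> zeval h P = zeval h' P.
Proof.
by move=> eqh; apply: eq_bigr => m _; congr (_ * _); apply: mmap1_eq.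
Qed.

Lemma rmorph_zeval (f : {rmorphism R -> S}) h P :
  f (zeval h P) = zeval (f \o h) P.
Proof.
rewrite /zeval /mmap rmorph_sum; apply: eq_bigr => m _.
rewrite rmorphM rmorph_int; congr (_ * _).
by rewrite rmorph_prod; apply: eq_bigr => i _; rewrite rmorphXn.
Qed.

End Zeval.

Lemma rmorph_zeval2 (R S : comNzRingType) (f : {rmorphism R -> S}) P a b :
  f (zeval2 P a b) = zeval2 P (f a) (f b).
Proof.
rewrite /zeval2 rmorph_zeval; apply: eq_zeval => i /=.
by rewrite !(tnth_nth 0); case: i => [[|[]]].
Qed.

Section Congruence.
Variables (p : nat) (R : comNzRingType).
Implicit Types (a b c d : R) (n : nat).

Definition eqmodp n a b := exists c, a - b = (p ^ n)%:R * c.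

Lemma eqmodp_refl n a : eqmodp n a a.
Proof. by exists 0; rewrite subrr mulr0. Qed.

Lemma eqmodp_trans n b a c : eqmodp n a b -> eqmodp n b c -> eqmodp n a c.
Proof.
by move=> [x ax] [y bx]; exists (x + y); rewrite mulrDr -ax -bx addrA subrK.
Qed.

Lemma eqmodp_sym n a b : eqmodp n a b -> eqmodp n b a.
Proof. by move=> [x ax]; exists (- x); rewrite mulrN -ax opprB. Qed.

Lemma eqmodpD n a b c d :
  eqmodp n a b -> eqmodp n c d -> eqmodp n (a + c) (b + d).
Proof.
by move=> [x ax] [y bx]; exists (x + y); rewrite mulrDr -ax -bx opprD addrACA.
Qed.

Lemma eqmodpN n a b : eqmodp n a b -> eqmodp n (- a) (- b).
Proof. by move=> [x ax]; exists (- x); rewrite mulrN -ax opprD. Qed.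

Lemma eqmodpM n a b c d :
  eqmodp n a b -> eqmodp n c d -> eqmodp n (a * c) (b * d).
Proof.
move=> [x ax] [y bx]; exists (x * c + b * y).
by rewrite mulrDr mulrA -ax mulrCA -bx mulrBl mulrBr addrA subrK.
Qed.

Lemma eqmodp_sum n (I : Type) (r : seq I) (P : pred I) (F G : I -> R) :
  (forall i, P i -> eqmodp n (F i) (G i)) ->
  eqmodp n (\sum_(i <- r | P i) F i) (\sum_(i <- r | P i) G i).
Proof.
move=> FG; apply: (big_ind2 (eqmodp n)) => //; first exact: eqmodp_refl.
by move=> *; apply: eqmodpD.
Qed.

Lemma eqmodp_prod n (I : Type) (r : seq I) (P : pred I) (F G : I -> R) :
  (forall i, P i -> eqmodp n (F i) (G i)) ->
  eqmodp n (\prod_(i <- r | P i) F i) (\prod_(i <- r | P i) G i).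
Proof.
move=> FG; apply: (big_ind2 (eqmodp n)) => //; first exact: eqmodp_refl.
by move=> *; apply: eqmodpM.
Qed.

Lemma eqmodpX n k a b : eqmodp n a b -> eqmodp n (a ^+ k) (b ^+ k).
Proof.
move=> ab; elim: k => [|k IH]; first exact: eqmodp_refl.
by rewrite !exprS; apply: eqmodpM.
Qed.

Lemma eqmodp_zeval2 n P a b c d :
  eqmodp n a b -> eqmodp n c d -> eqmodp n (zeval2 P a c) (zeval2 P b d).
Proof.
move=> ab cd; apply: eqmodp_sum => m _; apply: eqmodpM.
  exact: eqmodp_refl.
apply: eqmodp_prod => i _; apply: eqmodpX.
by rewrite !(tnth_nth 0); case: i => [[|[]]].
Qed.

Lemma eqmodp_scale n k a b :
  eqmodp n a b -> eqmodp (k + n) ((p ^ k)%:R * a) ((p ^ k)%:R * b).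
Proof. by move=> [x ax]; exists x; rewrite -mulrBr ax mulrA expnD natrM. Qed.

Hypothesis p_pr : prime p.

Lemma eqmodpXp n a b : (0 < n)%N -> eqmodp n a b -> eqmodp n.+1 (a ^+ p) (b ^+ p).
Proof.
move=> n_gt0 [x /(canRL (subrK _)) ->]; set y := _ * x.
have [z yy] : exists z, y * y = (p ^ n.+1)%:R * z.
  exists ((p ^ n.-1)%:R * x * x).
  rewrite /y mulrACA -natrM -expnD !mulrA -natrM -expnD; congr (_%:R * _ * _).
  by congr (p ^ _)%N; rewrite addSnnS prednK.
rewrite exprDn big_ord_recr /= subnn binn expr0 mul1r mulr1n.
exists (\sum_(i < p) if i == 0 :> nat then z * y ^+ (p - 2)
        else x * y ^+ (p - i).-1 * b ^+ i * ('C(p, i) %/ p)%:R).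
rewrite addrK mulr_sumr; apply: eq_bigr => i _.
have [i0|i_gt0] := posnP i.
  rewrite i0 subn0 expr0 mulr1 bin0 mulr1n mulrA -yy -expr2 -exprD.
  by rewrite subnKC // prime_gt1.
have pi_gt0 : (0 < p - i)%N by rewrite subn_gt0.
rewrite -(prednK pi_gt0) exprS {1}/y.
have /divnK <- : (p %| 'C(p, i))%N by rewrite prime_dvd_bin // i_gt0 /=.
by rewrite -mulr_natr natrM mulnK ?prime_gt0 // expnSr natrM; ring.
Qed.

Lemma eqmodpXpn n k a b :
  (0 < n)%N -> eqmodp n a b -> eqmodp (n + k) (a ^+ (p ^ k)) (b ^+ (p ^ k)).
Proof.
move=> n_gt0 ab; elim: k => [|k IH]; first by rewrite addn0 !expr1.
by rewrite addnS expnSr !exprM; apply: eqmodpXp; rewrite // addn_gt0 n_gt0.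
Qed.

Lemma eqmodpXDp a b : eqmodp 1 ((a + b) ^+ p) (a ^+ p + b ^+ p).
Proof.
have /prednK p1 := prime_gt0 p_pr; have p2 := prime_gt1 p_pr.
rewrite exprDn big_ord_recr /= subnn binn expr0 mul1r mulr1n.
apply: eqmodpD; last exact: eqmodp_refl.
rewrite -p1 big_ord_recl /= p1.
rewrite subn0 expr0 mulr1 bin0 mulr1n -[X in eqmodp _ _ X]addr0.
apply: eqmodpD; first exact: eqmodp_refl.
rewrite [X in eqmodp 1 _ X](_ : 0 = \sum_(i < p.-1) 0); last by rewrite big1.
apply: eqmodp_sum => i _; rewrite /bump leq0n add1n.
have /divnK <- : (p %| 'C(p, i.+1))%N.
  by rewrite prime_dvd_bin //= -[ltnRHS]p1 ltnS.
exists (a ^+ (p - i.+1) * b ^+ i.+1 * ('C(p, i.+1) %/ p)%:R).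
rewrite subr0 expn1 -mulr_natr natrM.
set c := (_ %/ _)%:R; rewrite [in RHS]/c; ring.
Qed.

End Congruence.

(* The i-th ghost component, in 0-based indexing. *)
Definition ghost (p : nat) (R : comNzRingType) (x : seq R) (i : nat) : R :=
  \sum_(j < i.+1) (p ^ j)%:R * x`_j ^+ (p ^ (i - j)).

Lemma ghost_recr p (R : comNzRingType) (x : seq R) i :
  ghost p x i =
  \sum_(j < i) (p ^ j)%:R * x`_j ^+ (p ^ (i - j)) + (p ^ i)%:R * x`_i.
Proof. by rewrite /ghost big_ord_recr /= subnn expr1. Qed.

Lemma rmorph_ghost p (R S : comNzRingType) (f : {rmorphism R -> S}) x i :
  f (ghost p x i) = ghost p (map f x) i.
Proof.
rewrite rmorph_sum; apply: eq_bigr => j _.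
rewrite rmorphM rmorph_nat rmorphXn; congr (_ * _ ^+ _).
have [ltjx|lexj] := ltnP j (size x); first by rewrite (nth_map 0).
by rewrite !nth_default ?size_map // rmorph0.
Qed.

Lemma eq_ghost p (R : comNzRingType) (x y : seq R) i :
  (forall j, (j <= i)%N -> x`_j = y`_j) -> ghost p x i = ghost p y i.
Proof.
by move=> eqxy; apply: eq_bigr => j _; rewrite eqxy // -ltnS.
Qed.

Section Dwork.
Variables (p N : nat) (p_pr : prime p).
Notation U := {mpoly int[N]}.

Definition mfrob : U -> U := zeval (fun i => 'X_i ^+ p).
HB.instance Definition _ := GRing.RMorphism.on mfrob.

Lemma mfrob_eqmodp f : eqmodp p 1 (mfrob f) (f ^+ p).
Proof.
pose good g := eqmodp p 1 (mfrob g) (g ^+ p).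
have good0 : good 0.
  rewrite /good rmorph0 expr0n gtn_eqF ?prime_gt0 //; exact: eqmodp_refl.
have goodD g h : good g -> good h -> good (g + h).
  move=> gg gh; rewrite /good rmorphD.
  apply: eqmodp_trans (eqmodp_sym (eqmodpXDp p_pr g h)).
  exact: eqmodpD.
have goodN g : good g -> good (- g).
  move=> gg; rewrite /good rmorphN.
  apply: (eqmodp_trans (eqmodpN gg)).
  have := eqmodpD (eqmodpXDp p_pr g (- g)) (eqmodp_refl p 1 (- g ^+ p)).
  by rewrite subrr expr0n gtn_eqF ?prime_gt0 // add0r addrAC subrr add0r.
have goodX m : good 'X_[m].
  rewrite /good /mfrob zevalX /mmap1 mpolyXE_id -prodrXl.
  by apply: eqmodp_prod => i _; rewrite exprAC; apply: eqmodp_refl.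
have goodMn g n : good g -> good (g *+ n).
  move=> gg; elim: n => [|n IH]; first by rewrite mulr0n.
  by rewrite mulrS; apply: (goodD).
rewrite -/(good f); elim/mpolyind: f => // c m f _ _; apply: (goodD).
rewrite -(intz c) scaler_int.
case: c => n; first by apply: (goodMn).
by rewrite NegzE mulrNz; apply: (goodN); apply: (goodMn).
Qed.

(* Dwork's lemma *)
Lemma ghost_onto (a : nat -> U) :
  (forall i, eqmodp p i.+1 (mfrob (a i)) (a i.+1)) ->
  forall n, exists2 s : seq U, size s = n & forall i, (i < n)%N -> ghost p s i = a i.
Proof.
move=> aP; elim=> [|n [s sz_s gs]]; first by exists [::].
suff [c ac] : eqmodp p n (a n) (\sum_(j < n) (p ^ j)%:R * s`_j ^+ (p ^ (n - j))).
  exists (rcons s c) => [|i]; first by rewrite size_rcons sz_s.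
  rewrite ltnS leq_eqVlt => /orP[/eqP->|lt_in].
    rewrite /ghost big_ord_recr /= nth_rcons sz_s ltnn eqxx subnn expn0 expr1.
    rewrite -ac addrC -[RHS](subrK (\sum_(j < n) (p ^ j)%:R * s`_j ^+ (p ^ (n - j)))).
    congr (_ + _); apply: eq_bigr => j _.
    by rewrite nth_rcons sz_s ltn_ord.
  rewrite -(gs i lt_in); apply: eq_ghost => j le_ji.
  by rewrite nth_rcons sz_s (leq_ltn_trans le_ji).
case: n => [|n] in s sz_s gs *.
  by exists (a 0%N); rewrite big_ord0 subr0 expn0 mul1r.
apply: eqmodp_trans (eqmodp_sym (aP n)) _.
rewrite -(gs n (ltnSn n)) rmorph_sum.
apply: eqmodp_sum => j _; rewrite rmorphM rmorph_nat [X in _ * X]rmorphXn.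
have le_jn : (j <= n)%N by rewrite -ltnS.
rewrite subSn // expnS exprM.
have := eqmodp_scale j (eqmodpXpn p_pr (n - j) (ltn0Sn 0) (mfrob_eqmodp s`_j)).
by rewrite add1n addnS subnKC.
Qed.

End Dwork.

Section WittPolynomials.
Variables (p : nat) (p_pr : prime p) (m : nat).

Definition wvarl : m.-tuple {mpoly int[m + m]} := [tuple 'X_(lshift m i) | i < m].
Definition wvarr : m.-tuple {mpoly int[m + m]} := [tuple 'X_(rshift m i) | i < m].

Fact witt_poly_subproof (P : {mpoly int[2]}) :
  exists S : m.-tuple {mpoly int[m + m]},
    [forall i : 'I_m, ghost p S i == zeval2 P (ghost p wvarl i) (ghost p wvarr i)].
Proof.
pose a i := zeval2 P (ghost p wvarl i) (ghost p wvarr i).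
have frobP (x : m.-tuple {mpoly int[m + m]}) i :
    (forall j, mfrob p (tnth x j) = tnth x j ^+ p) ->
    eqmodp p i.+1 (mfrob p (ghost p x i)) (ghost p x i.+1).
  move=> xP; rewrite [X in eqmodp _ _ _ X]/ghost big_ord_recr /= subnn expn0.
  rewrite -[mfrob _ _]addr0; apply: eqmodpD; last first.
    by exists (- x`_i.+1); rewrite sub0r mulrN.
  rewrite rmorph_ghost; apply: eqmodp_sum => j _.
  have le_ji : (j <= i)%N by rewrite -ltnS.
  rewrite subSn // expnS exprM.
  have [lt_jm|le_mj] := ltnP j m.
    rewrite (nth_map 0) ?size_tuple //.
    have := xP (Ordinal lt_jm); rewrite (tnth_nth 0) /= => <-.
    exact: eqmodp_refl.
  rewrite !nth_default ?size_map ?size_tuple // [0 ^+ p]expr0n.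
  by rewrite (gtn_eqF (prime_gt0 p_pr)); apply: eqmodp_refl.
have aP i : eqmodp p i.+1 (mfrob p (a i)) (a i.+1).
  rewrite /a rmorph_zeval2; apply: eqmodp_zeval2; apply: frobP => j;
  by rewrite tnth_mktuple /mfrob zevalXU.
have [s sz_s gs] := ghost_onto p_pr aP m.
by exists (Tuple (introT eqP sz_s)); apply/forallP => i; rewrite gs.
Qed.

(* The tuple (S_0, ..., S_(m-1)) of integral polynomials in the variables
   X_0, ..., X_(m-1), Y_0, ..., Y_(m-1) such that w_i(S) = P(w_i(X), w_i(Y)) for
   all i < m, where w_i is the i-th ghost component. *)
Definition witt_poly (P : {mpoly int[2]}) : m.-tuple {mpoly int[m + m]} :=
  xchoose (witt_poly_subproof P).

Lemma witt_polyP P (i : 'I_m) :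
  ghost p (witt_poly P) i = zeval2 P (ghost p wvarl i) (ghost p wvarr i).
Proof. exact/eqP/(forallP (xchooseP (witt_poly_subproof P)) i). Qed.

End WittPolynomials.

(* W_m(R): p-typical Witt vectors of length m, with components numbered from 0. *)
Definition witt (p : nat) (p_pr : prime p) (m : nat) (R : Type) : Type :=
  m.-tuple R.

HB.instance Definition _ p p_pr m (R : choiceType) :=
  Choice.copy (@witt p p_pr m R) (m.-tuple R).
HB.instance Definition _ p p_pr m (R : finType) :=
  Finite.copy (@witt p p_pr m R) (m.-tuple R).

Definition wmap p p_pr m (R S : Type) (f : R -> S) (x : @witt p p_pr m R) :
  @witt p p_pr m S := map_tuple f x.

Definition wenv (R : Type) n k (x : n.-tuple R) (y : k.-tuple R)
  (i : 'I_(n + k)) : R :=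
  match split i with inl j => tnth x j | inr j => tnth y j end.

HB.lock Definition wop p p_pr m (R : comNzRingType) (P : {mpoly int[2]})
  (x y : @witt p p_pr m R) : witt p_pr m R :=
  [tuple zeval (wenv x y) (tnth (witt_poly p_pr m P) i) | i < m].

Lemma tnth_wop p p_pr m (R : comNzRingType) P (x y : @witt p p_pr m R) i :
  tnth (wop P x y) i = zeval (wenv x y) (tnth (witt_poly p_pr m P) i).
Proof. by rewrite wop.unlock tnth_mktuple. Qed.

Section WittRing.
Variables (p : nat) (p_pr : prime p) (m : nat).

Section Ops.
Variable R : comNzRingType.
Notation W := (witt p_pr m R).
Implicit Types x y z : W.

Definition wzero : W := [tuple 0 | i < m].
Definition wone : W := [tuple (i == 0 :> nat)%:R | i < m].
Definition wopp x : W := wop (- 'X_ord0) x x.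
Definition wadd x y : W := wop ('X_ord0 + 'X_ord_max) x y.
Definition wmul x y : W := wop ('X_ord0 * 'X_ord_max) x y.

Lemma wenvl n k (x : n.-tuple R) (y : k.-tuple R) j :
  wenv x y (lshift k j) = tnth x j.
Proof. by rewrite /wenv (unsplitK (inl j)). Qed.

Lemma wenvr n k (x : n.-tuple R) (y : k.-tuple R) j :
  wenv x y (rshift n j) = tnth y j.
Proof. by rewrite /wenv (unsplitK (inr j)). Qed.

Lemma ghost_wop P x y (i : 'I_m) :
  ghost p (wop P x y) i = zeval2 P (ghost p x i) (ghost p y i).
Proof.
pose f := zeval (wenv x y) : {mpoly int[m + m]} -> R.
have -> : wop P x y = map_tuple f (witt_poly p_pr m P).
  by apply: eq_from_tnth => j; rewrite (tnth_map f) tnth_wop.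
rewrite -(rmorph_ghost p (zeval (wenv x y))) witt_polyP.
rewrite (rmorph_zeval2 (zeval (wenv x y))).
congr zeval2; rewrite (rmorph_ghost p (zeval (wenv x y))).
  congr (ghost p (tval _) i); apply: (@eq_from_tnth _ _ (map_tuple f _)) => j.
  by rewrite (tnth_map f) tnth_mktuple /f zevalXU wenvl.
congr (ghost p (tval _) i); apply: (@eq_from_tnth _ _ (map_tuple f _)) => j.
by rewrite (tnth_map f) tnth_mktuple /f zevalXU wenvr.
Qed.

Lemma ghost_wzero (i : 'I_m) : ghost p wzero i = 0.
Proof.
apply: big1 => j _; have lt_jm := leq_ltn_trans (leq_ord j) (ltn_ord i).
rewrite -(tnth_nth 0 wzero (Ordinal lt_jm)) tnth_mktuple expr0n.
by rewrite gtn_eqF ?mulr0 // expn_gt0 prime_gt0.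
Qed.

Lemma ghost_wone (i : 'I_m) : ghost p wone i = 1.
Proof.
have m_gt0 : (0 < m)%N by apply: leq_ltn_trans (ltn_ord i).
rewrite /ghost big_ord_recl big1 /= => [|j _].
  by rewrite -(tnth_nth 0 wone (Ordinal m_gt0)) tnth_mktuple expr1n mulr1 addr0.
have lt_jm : (bump 0 j < m)%N.
  by rewrite /bump leq0n add1n (leq_ltn_trans _ (ltn_ord i)).
rewrite -(tnth_nth 0 wone (Ordinal lt_jm)) tnth_mktuple /= expr0n.
by rewrite gtn_eqF ?mulr0 // expn_gt0 prime_gt0.
Qed.

End Ops.

Lemma wmap_wop (R S : comNzRingType) (f : {rmorphism R -> S}) P
    (x y : witt p_pr m R) :
  wmap f (wop P x y) = wop P (wmap f x) (wmap f y).
Proof.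
apply: eq_from_tnth => i; rewrite tnth_map !tnth_wop rmorph_zeval.
apply: eq_zeval => j; rewrite /wenv /=.
by case: (split j) => j'; rewrite tnth_map.
Qed.

Section WmapOps.
Variables (R S : comNzRingType) (f : {rmorphism R -> S}).
Implicit Types x y : witt p_pr m R.

Lemma wmap_wadd x y : wmap f (wadd x y) = wadd (wmap f x) (wmap f y).
Proof. exact: wmap_wop. Qed.

Lemma wmap_wmul x y : wmap f (wmul x y) = wmul (wmap f x) (wmap f y).
Proof. exact: wmap_wop. Qed.

Lemma wmap_wopp x : wmap f (wopp x) = wopp (wmap f x).
Proof. exact: wmap_wop. Qed.

Lemma wmap_wzero : wmap f (wzero R) = wzero S.
Proof.
by apply: eq_from_tnth => i; rewrite tnth_map !tnth_mktuple rmorph0.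
Qed.

Lemma wmap_wone : wmap f (wone R) = wone S.
Proof.
by apply: eq_from_tnth => i; rewrite tnth_map !tnth_mktuple rmorph_nat.
Qed.

End WmapOps.

Lemma ghost_inj (R : idomainType) (x y : witt p_pr m R) :
  p%:R != 0 :> R -> (forall i : 'I_m, ghost p x i = ghost p y i) -> x = y.
Proof.
move=> p_neq0 gxy; suff xy i : (i < m)%N -> x`_i = y`_i.
  by apply: eq_from_tnth => i; rewrite !(tnth_nth 0) xy.
elim/ltn_ind: i => i IH lt_im.
have /= := gxy (Ordinal lt_im); rewrite (ghost_recr p x) (ghost_recr p y).
have -> : \sum_(j < i) (p ^ j)%:R * x`_j ^+ (p ^ (i - j)) =
          \sum_(j < i) (p ^ j)%:R * y`_j ^+ (p ^ (i - j)).
  by apply: eq_bigr => j _; rewrite IH // (ltn_trans (ltn_ord j)).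
by move/addrI; apply: mulfI; rewrite natrX expf_neq0.
Qed.

Lemma mpoly_int_natr_neq0 N : p%:R != 0 :> {mpoly int[N]}.
Proof. by rewrite -mpolyC_nat mpolyC_eq0 pnatr_eq0 -lt0n prime_gt0. Qed.

Lemma ghostD (R : comNzRingType) (x y : witt p_pr m R) (i : 'I_m) :
  ghost p (wadd x y) i = ghost p x i + ghost p y i.
Proof. by rewrite ghost_wop /zeval2 rmorphD /= !zevalXU. Qed.

Lemma ghostN (R : comNzRingType) (x : witt p_pr m R) (i : 'I_m) :
  ghost p (wopp x) i = - ghost p x i.
Proof. by rewrite ghost_wop /zeval2 rmorphN /= zevalXU. Qed.

Lemma ghostM (R : comNzRingType) (x y : witt p_pr m R) (i : 'I_m) :
  ghost p (wmul x y) i = ghost p x i * ghost p y i.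
Proof. by rewrite ghost_wop /zeval2 rmorphM /= !zevalXU. Qed.

Section RingAxioms.
Variable R : comNzRingType.
Implicit Types x y z : witt p_pr m R.

Notation A := {mpoly int[m + (m + m)]}.

(* Any three Witt vectors are images of Witt vectors over a polynomial ring. *)
Lemma witt_lift x y z :
  exists (f : {rmorphism A -> R}) (x' y' z' : witt p_pr m A),
  [/\ wmap f x' = x, wmap f y' = y & wmap f z' = z].
Proof.
exists (zeval (wenv x [tuple wenv y z i | i < m + m])).
exists [tuple 'X_(lshift _ i) | i < m].
exists [tuple 'X_(rshift _ (lshift _ i)) | i < m].
exists [tuple 'X_(rshift _ (rshift _ i)) | i < m].
split; apply: eq_from_tnth => i; rewrite tnth_map tnth_mktuple /= zevalXU.
- by rewrite wenvl.
- by rewrite wenvr tnth_mktuple wenvl.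
- by rewrite wenvr tnth_mktuple wenvr.
Qed.

Fact waddA : associative (@wadd R).
Proof.
move=> x y z; have [f [x' [y' [z' [<- <- <-]]]]] := witt_lift x y z.
suff /(congr1 (wmap f)) : wadd x' (wadd y' z') = wadd (wadd x' y') z'.
  by rewrite !(wmap_wadd f).
apply: (ghost_inj (mpoly_int_natr_neq0 _)) => i.
by rewrite !ghostD addrA.
Qed.

Fact waddC : commutative (@wadd R).
Proof.
move=> x y; have [f [x' [y' [_ [<- <- _]]]]] := witt_lift x y y.
suff /(congr1 (wmap f)) : wadd x' y' = wadd y' x'.
  by rewrite !(wmap_wadd f).
apply: (ghost_inj (mpoly_int_natr_neq0 _)) => i.
by rewrite !ghostD addrC.
Qed.

Fact wadd0 : left_id (wzero R) (@wadd R).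
Proof.
move=> x; have [f [x' [_ [_ [<- _ _]]]]] := witt_lift x x x.
suff /(congr1 (wmap f)) : wadd (wzero _) x' = x'.
  by rewrite !(wmap_wadd f) wmap_wzero.
apply: (ghost_inj (mpoly_int_natr_neq0 _)) => i.
by rewrite ghostD ghost_wzero add0r.
Qed.

Fact waddN : left_inverse (wzero R) (@wopp R) (@wadd R).
Proof.
move=> x; have [f [x' [_ [_ [<- _ _]]]]] := witt_lift x x x.
suff /(congr1 (wmap f)) : wadd (wopp x') x' = wzero _.
  by rewrite !(wmap_wadd f) wmap_wopp wmap_wzero.
apply: (ghost_inj (mpoly_int_natr_neq0 _)) => i.
by rewrite ghostD ghostN ghost_wzero addNr.
Qed.

Fact wmulA : associative (@wmul R).
Proof.
move=> x y z; have [f [x' [y' [z' [<- <- <-]]]]] := witt_lift x y z.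
suff /(congr1 (wmap f)) : wmul x' (wmul y' z') = wmul (wmul x' y') z'.
  by rewrite !(wmap_wmul f).
apply: (ghost_inj (mpoly_int_natr_neq0 _)) => i.
by rewrite !ghostM mulrA.
Qed.

Fact wmulC : commutative (@wmul R).
Proof.
move=> x y; have [f [x' [y' [_ [<- <- _]]]]] := witt_lift x y y.
suff /(congr1 (wmap f)) : wmul x' y' = wmul y' x'.
  by rewrite !(wmap_wmul f).
apply: (ghost_inj (mpoly_int_natr_neq0 _)) => i.
by rewrite !ghostM mulrC.
Qed.

Fact wmul1 : left_id (wone R) (@wmul R).
Proof.
move=> x; have [f [x' [_ [_ [<- _ _]]]]] := witt_lift x x x.
suff /(congr1 (wmap f)) : wmul (wone _) x' = x'.
  by rewrite !(wmap_wmul f) wmap_wone.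
apply: (ghost_inj (mpoly_int_natr_neq0 _)) => i.
by rewrite ghostM ghost_wone mul1r.
Qed.

Fact wmulD : left_distributive (@wmul R) (@wadd R).
Proof.
move=> x y z; have [f [x' [y' [z' [<- <- <-]]]]] := witt_lift x y z.
suff /(congr1 (wmap f)) : wmul (wadd x' y') z' = wadd (wmul x' z') (wmul y' z').
  by rewrite !(wmap_wadd f, wmap_wmul f).
apply: (ghost_inj (mpoly_int_natr_neq0 _)) => i.
by rewrite !(ghostD, ghostM) mulrDl.
Qed.

HB.instance Definition _ :=
  GRing.isZmodule.Build (witt p_pr m R) waddA waddC wadd0 waddN.
HB.instance Definition _ :=
  GRing.Zmodule_isComPzRing.Build (witt p_pr m R) wmulA wmulC wmul1 wmulD.

End RingAxioms.
End WittRing.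

HB.instance Definition _ p p_pr m (R : finComNzRingType) :=
  Finite.on (@witt p p_pr m R).

(* As in zmodp.v for 'Z_p, the group law is the Witt vector addition. *)
HB.instance Definition _ p p_pr m (R : finComNzRingType) :=
  [finGroupMixin of @witt p p_pr m R for +%R].

(* The vector of componentwise q-th powers; x ^+ q is the Witt power. *)
Definition wpow p p_pr m (R : comNzRingType) (q : nat) (x : @witt p p_pr m R) :
  witt p_pr m R := wmap (fun a => a ^+ q) x.

(* abelian_type lists the orders of the factors in a decomposition of an abelian
   group as a direct product of nontrivial cyclic groups (abelian_structure). *)
Definition abelian_p_extension (k : fieldType) (L : splittingFieldType k)
    (p h l : nat) (K : {vspace L}) : Prop :=
  let G := 'Gal(K / 1)%g in
  [/\ galois 1 K, abelian G, (p.-group G)%g,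
      exponent G = (p ^ h)%N & size (abelian_type G) = l].

(* Main.v *)
Require Import Defs.
From Stdlib Require Import Classical_Prop.
From HB Require Import structures.
From mathcomp Require Import all_boot all_order all_fingroup all_algebra.
From mathcomp Require Import all_solvable all_field.
From mathcomp Require Import mpoly ring.

Set Implicit Arguments.
Unset Strict Implicit.
Unset Printing Implicit Defensive.

Import GRing.Theory.
Local Open Scope ring_scope.

(** Write q = p ^ n, F for the componentwise q-th power, and j for the map
    induced on Witt vectors by the inclusion of the field with q elements.  In
    characteristic p the map F is additive, being functorially induced by a
    power of the Frobenius, and the solutions of F d = d are the vectors with
    all their components in the field with q elements ([wpow_fixed]).

    All the information on the addition of Witt vectors that is needed comes
    from the filtration by the vectors whose first i components vanish:
    addition is triangular with respect to it, and on its i-th step the i-th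
    component is additive ([nthD_vanish]).  In characteristic p, multiplication
    by p moves the filtration up by one and acts on leading components as the
    Frobenius ([vanishMp], [nthMp_char]).  Hence p ^ m kills the Witt vectors
    of length m, and over the field with q elements the p-torsion is the last
    step of the filtration, of order q.  So that finite group, of order q ^ m,
    has exponent dividing p ^ m and rank at most n ([witt_exponent],
    [witt_rank]); being that large, it is homocyclic, a power of the cyclic
    group of order p ^ m, and contains a copy of every abelian p-group of
    exponent dividing p ^ m and rank at most n ([abelian_embedding]).

    Direct part.  A finite splitting field L inside the closure holds the
    components of the root ([algebraic_splitting_subfield]), so everything
    happens in L.  Two roots y and s y of the same equation differ by a
    fixed point of F, that is s y = y + j c.  Therefore K = k(y) is normal.  It
    is separable because, triangularity again, y_i - y_i ^ q lies in the field
    generated by the earlier components.  Finally s |-> c is an injective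
    morphism from the Galois group to the Witt vectors over the field with q
    elements ([gal_translation]), and the bounds on that group apply.

    Converse.  Embed the Galois group in the Witt vectors over the field with q
    elements by xi.  As the Galois action fixes these vectors, xi is a
    1-cocycle in the Witt vectors over K, and the additive Hilbert 90 theorem,
    applied to one component after the other, makes it a coboundary
    ([witt_Hilbert90]): s y = y + j (xi s).  Then F y - y is Galois invariant,
    so it is defined over k, and k(y) is fixed by the identity alone, so it is
    all of K. *)

(** * The filtration of the Witt vectors *)

Section WittFiltration.
Variables (p : nat) (p_pr : prime p) (m : nat).
Local Notation W := (witt p_pr m).

Section Components.
Variable R : comNzRingType.
Implicit Types x y v : W R.

Definition wlow i x : W R := [tuple (if (j < i)%N then x`_j else 0) | j < m].
Definition whigh i x : W R := [tuple (if (j < i)%N then 0 else x`_j) | j < m].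
Definition wvanish i x := forall j, (j < i)%N -> x`_j = 0.

Lemma nth_wlow i x j : (wlow i x)`_j = if (j < i)%N then x`_j else 0.
Proof.
have [ltjm|lemj] := ltnP j m.
  by rewrite -(tnth_nth 0 (wlow i x) (Ordinal ltjm)) tnth_mktuple.
by rewrite !nth_default ?size_tuple // if_same.
Qed.

Lemma nth_whigh i x j : (whigh i x)`_j = if (j < i)%N then 0 else x`_j.
Proof.
have [ltjm|lemj] := ltnP j m.
  by rewrite -(tnth_nth 0 (whigh i x) (Ordinal ltjm)) tnth_mktuple.
by rewrite !nth_default ?size_tuple // if_same.
Qed.

Lemma witt_ext x y : (forall j, (j < m)%N -> x`_j = y`_j) -> x = y.
Proof. by move=> eqxy; apply: eq_from_tnth => j; rewrite !(tnth_nth 0) eqxy. Qed.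

Lemma whigh_vanish i x : wvanish i (whigh i x).
Proof. by move=> j ltji; rewrite nth_whigh ltji. Qed.

Lemma whigh_id i x : wvanish i x -> whigh i x = x.
Proof.
by move=> xi; apply: witt_ext => j _; rewrite nth_whigh; case: ifP => // /xi.
Qed.

Lemma nth_wzero j : (0 : W R)`_j = 0.
Proof.
have [ltjm|lemj] := ltnP j m; last by rewrite nth_default ?size_tuple.
by rewrite -(tnth_nth 0 (0 : W R) (Ordinal ltjm)) tnth_mktuple.
Qed.

End Components.

Lemma nth_wmap (R S : comNzRingType) (f : {rmorphism R -> S}) (x : W R) j :
  (wmap f x)`_j = f x`_j.
Proof.
have [ltjm|lemj] := ltnP j m; first by rewrite (nth_map 0) ?size_tuple.
by rewrite !nth_default ?size_map ?size_tuple // rmorph0.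
Qed.

Lemma wmap_low (R S : comNzRingType) (f : {rmorphism R -> S}) i (x : W R) :
  wmap f (wlow i x) = wlow i (wmap f x).
Proof.
apply: witt_ext => j _; rewrite nth_wlow !nth_wmap nth_wlow.
by case: ifP; rewrite ?rmorph0.
Qed.

Lemma wmap_high (R S : comNzRingType) (f : {rmorphism R -> S}) i (x : W R) :
  wmap f (whigh i x) = whigh i (wmap f x).
Proof.
apply: witt_ext => j _; rewrite nth_whigh !nth_wmap nth_whigh.
by case: ifP; rewrite ?rmorph0.
Qed.

Section WmapRing.
Variables (R S : comNzRingType) (f : {rmorphism R -> S}).
Lemma wmapD (x y : W R) : wmap f (x + y) = wmap f x + wmap f y.
Proof. exact: wmap_wadd. Qed.
Lemma wmapN (x : W R) : wmap f (- x) = - wmap f x.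
Proof. exact: wmap_wopp. Qed.
Lemma wmapB (x y : W R) : wmap f (x - y) = wmap f x - wmap f y.
Proof. by rewrite wmapD wmapN. Qed.
Lemma wmap0 : wmap f (0 : W R) = 0.
Proof. exact: wmap_wzero. Qed.
Lemma wmapMn (x : W R) n : wmap f (x *+ n) = wmap f x *+ n.
Proof. by elim: n => [|n IH]; rewrite ?wmap0 // !mulrS wmapD IH. Qed.
End WmapRing.

Lemma wmap_inj (R S : comNzRingType) (f : {rmorphism R -> S}) : injective f ->
  injective (wmap f : W R -> W S).
Proof.
move=> injf x y eqxy; apply: witt_ext => j _; apply: injf.
by rewrite -!nth_wmap eqxy.
Qed.

(** The j-th ghost component is a sum of terms each involving one component, so
    that it is additive for vectors with disjoint supports. *)
Lemma wlow_high (R : comNzRingType) i (x : W R) : x = wlow i x + whigh i x.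
Proof.
have [f [x' [_ [_ [<- _ _]]]]] := witt_lift x x x.
rewrite -!(wmap_low f, wmap_high f, wmapD f); congr wmap.
apply: (ghost_inj (mpoly_int_natr_neq0 p_pr _)) => j.
rewrite ghostD -big_split; apply: eq_bigr => l _ /=.
have p0 : (0 < p ^ (j - l))%N by rewrite expn_gt0 prime_gt0.
rewrite nth_wlow nth_whigh; case: ifP => _; rewrite [0 ^+ _]expr0n gtn_eqF //.
  by rewrite mulr0 addr0.
by rewrite mulr0 add0r.
Qed.

(** The ghost component of index j determines the component of index j from the
    previous ones, when p is not a zero divisor. *)
Lemma ghost_step (R : idomainType) (w x u : seq R) j : p%:R != 0 :> R ->
  ghost p w j = ghost p x j + ghost p u j ->
  (forall l, (l < j)%N -> u`_l = 0) -> (forall l, (l < j)%N -> w`_l = x`_l) ->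
  w`_j = x`_j + u`_j.
Proof.
move=> nzp e u0 wx; move: e; rewrite !ghost_recr.
rewrite [X in _ + (X + _)]big1; last first.
  by move=> l _; rewrite u0 // expr0n gtn_eqF ?mulr0 // expn_gt0 prime_gt0.
rewrite (eq_bigr (fun l : 'I_j => (p ^ l)%:R * x`_l ^+ (p ^ (j - l)))); last first.
  by move=> l _; rewrite wx.
rewrite add0r -addrA -mulrDr => /addrI; apply: mulfI.
by rewrite natrX expf_neq0.
Qed.

(** It is enough to check this over the torsion-free ring that contains the
    generic Witt vectors, as specialisation preserves the vanishing of the first
    components once they have been replaced by zeros in the generic vector. *)
Lemma nthD_vanish (R : comNzRingType) i (x v : W R) : wvanish i v ->
  forall j, (j <= i)%N -> (x + v)`_j = x`_j + v`_j.
Proof.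
have [f [x' [v' [_ [<- <- _]]]]] := witt_lift x v v => vi.
have {vi} -> : wmap f v' = wmap f (whigh i v') by rewrite (wmap_high f) whigh_id.
move: (whigh i v') (@whigh_vanish _ i v') => u ui j leji.
rewrite -(wmapD f) !(nth_wmap f) -rmorphD; congr (f _).
elim/ltn_ind: j leji => j IH leji.
have [ltjm|lemj] := ltnP j m; last by rewrite !nth_default ?size_tuple // addr0.
have e := ghostD x' u (Ordinal ltjm).
apply: (ghost_step (mpoly_int_natr_neq0 p_pr _) e) => l ltlj.
  by rewrite ui // (leq_trans ltlj).
have lel := leq_trans (ltnW ltlj) leji.
by have -> := IH l ltlj lel; rewrite ui ?addr0 // (leq_trans ltlj).
Qed.

Section Subgroup.
Variable R : comNzRingType.
Implicit Types x y v : W R.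

Lemma vanishD i x y : wvanish i x -> wvanish i y -> wvanish i (x + y).
Proof. by move=> xi yi j ltji; rewrite (nthD_vanish _ yi) ?xi ?yi ?addr0 // ltnW. Qed.

Lemma vanish_nthN i x : wvanish i x -> forall j, (j <= i)%N -> (- x)`_j = - x`_j.
Proof.
move=> xi j leji; apply: (addIr x`_j); rewrite -(nthD_vanish _ xi) //.
by rewrite !addNr nth_wzero.
Qed.

Lemma vanishN i x : wvanish i x -> wvanish i (- x).
Proof. by move=> xi j ltji; rewrite (vanish_nthN xi) ?xi ?oppr0 // ltnW. Qed.

Lemma vanish_nthMn i x n : wvanish i x ->
  forall j, (j <= i)%N -> (x *+ n)`_j = x`_j *+ n.
Proof.
move=> xi; elim: n => [|n IH] j leji; first by rewrite nth_wzero.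
by rewrite !mulrSr (nthD_vanish _ xi) // IH.
Qed.

Lemma vanish_all x : wvanish m x -> x = 0.
Proof. by move=> xm; apply: witt_ext => j /xm ->; rewrite nth_wzero. Qed.

Lemma vanishS i x : wvanish i x -> x`_i = 0 -> wvanish i.+1 x.
Proof. by move=> xi xi0 j; rewrite ltnS leq_eqVlt => /predU1P[->|/xi]. Qed.

(** The addition law is triangular: the carry into the i-th component is a
    function of the earlier components alone. *)
Lemma nth_wadd i x y : (x + y)`_i = (wlow i x + wlow i y)`_i + (x`_i + y`_i).
Proof.
rewrite {1}[x](wlow_high i) {1}[y](wlow_high i) addrACA.
have xi := @whigh_vanish _ i x; have yi := @whigh_vanish _ i y.
rewrite (nthD_vanish _ (vanishD xi yi)) // (nthD_vanish _ yi) //.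
by rewrite !nth_whigh ltnn.
Qed.

End Subgroup.

(** When the components of index below i vanish, the ghost component of index
    i.+1 has two terms; comparing them for x and for p times x gives the
    component of index i.+1 of the latter, with (p x_i) ^ p = p ^ 2 (p ^ (p - 2)
    x_i ^ p) accounting for the correction. *)
Lemma ghost_stepMp (R : idomainType) (w x : seq R) i : p%:R != 0 :> R ->
  ghost p w i.+1 = ghost p x i.+1 *+ p ->
  (forall l, (l < i)%N -> x`_l = 0) -> (forall l, (l < i)%N -> w`_l = 0) ->
  w`_i = x`_i *+ p ->
  w`_i.+1 = x`_i ^+ p + p%:R * (x`_i.+1 - p%:R ^+ (p - 2) * x`_i ^+ p).
Proof.
move=> nzp e x0 w0 wi.
have ghost0 (y : seq R) : (forall l, (l < i)%N -> y`_l = 0) -> ghost p y i.+1 =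
    (p ^ i)%:R * y`_i ^+ p + (p ^ i.+1)%:R * y`_i.+1.
  move=> yi; rewrite ghost_recr big_ord_recr /= subSnn expn1 big1 ?add0r // => l _.
  by rewrite yi // expr0n gtn_eqF ?mulr0 // expn_gt0 prime_gt0.
move: e; rewrite !ghost0 // wi -[x`_i *+ p]mulr_natl -[RHS]mulr_natl.
rewrite exprMn expnS natrM.
have -> : p%:R ^+ p = p%:R * p%:R * p%:R ^+ (p - 2) :> R.
  by rewrite -expr2 -exprD subnKC // prime_gt1.
set P := _ ^+ (p - 2); set X := _ ^+ p; set q := (p ^ i)%:R => e.
apply: (@mulfI _ (q * p%:R)); first by rewrite mulf_neq0 // /q natrX expf_neq0.
apply: (addrI (q * (p%:R * p%:R * P * X))).
by rewrite [p%:R * q]mulrC in e; rewrite e; ring.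
Qed.

Lemma nthMp (R : comNzRingType) i (x : W R) : wvanish i x -> (i.+1 < m)%N ->
  exists c, (x *+ p)`_i.+1 = x`_i ^+ p + p%:R * c.
Proof.
have [f [x' [_ [_ [<- _ _]]]]] := witt_lift x x x => xi lt_im.
have {xi} -> : wmap f x' = wmap f (whigh i x') by rewrite (wmap_high f) whigh_id.
move: (whigh i x') (@whigh_vanish _ i x') => {x x'}x xi.
exists (f (x`_i.+1 - p%:R ^+ (p - 2) * x`_i ^+ p)).
rewrite -(wmapMn f) !(nth_wmap f) -rmorphXn -(rmorph_nat f) -rmorphM -rmorphD.
congr (f _).
have ghostMn (y : W {mpoly int[m + (m + m)]}) n (j : 'I_m) :
    ghost p (y *+ n) j = ghost p y j *+ n.
  elim: n => [|n IH]; first exact: ghost_wzero.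
  by rewrite !mulrSr -IH; apply: ghostD.
apply: (ghost_stepMp (mpoly_int_natr_neq0 p_pr _) (ghostMn x p (Ordinal lt_im))) => //.
  by move=> l ltli; rewrite (vanish_nthMn _ xi) ?xi ?mul0rn // ltnW.
by rewrite (vanish_nthMn _ xi).
Qed.

Section Char.
Variables (R : comNzRingType) (charR : p \in [pchar R]).
Implicit Types x : W R.

Lemma vanishMp i x : wvanish i x -> wvanish i.+1 (x *+ p).
Proof.
move=> xi; apply: vanishS => [j ltji|]; rewrite (vanish_nthMn _ xi) //.
- by rewrite xi ?mul0rn.
- by rewrite ltnW.
- by rewrite -mulr_natr pcharf0 ?mulr0.
Qed.

Lemma wittMp_length x : x *+ (p ^ m) = 0.
Proof.
apply: vanish_all; elim: {1 3}m => [|i IH]; first by [].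
by rewrite expnSr mulrnA; apply: vanishMp.
Qed.

(** In characteristic p, multiplication by p is the Frobenius followed by the
    shift; on leading components this is all that counting torsion requires. *)
Lemma nthMp_char i x : wvanish i x -> (i.+1 < m)%N -> (x *+ p)`_i.+1 = x`_i ^+ p.
Proof.
by move=> xi /(nthMp xi)[c ->]; rewrite pcharf0 // mul0r addr0.
Qed.

End Char.

End WittFiltration.

(** * Embedding abelian p-groups in a homocyclic group *)

Section AbelianGroups.
Local Open Scope group_scope.

(** The rank of a p-group is attained by an elementary abelian subgroup, all of
    whose elements are killed by p. *)
Lemma rank_le_torsion (gT : finGroupType) (p n : nat) (A : {group gT}) :
  prime p -> p.-group A -> (#|'Ldiv_p(A)| <= p ^ n)%N -> ('r(A) <= n)%N.
Proof.
move=> p_pr pA leLn; rewrite (rank_pgroup pA).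
have [E /pnElemPcard[sEA abE oE]] := p_rank_witness p A.
rewrite -(leq_exp2l _ _ (prime_gt1 p_pr)) -oE (leq_trans _ leLn) //.
by rewrite subset_leq_card // subsetI sEA sub_LdivT; case/and3P: abE.
Qed.

(** Subgroups of the factors of a direct product generate their own direct
    product. *)
Lemma bigdprod_cycleX (gT : finGroupType) (b : seq gT) (e : seq nat) (A : {group gT}) :
  \big[dprod/1]_(x <- b) <[x]> = A ->
  exists2 H : {group gT}, H \subset A &
    \big[dprod/1]_(z <- zip b e) <[z.1 ^+ z.2]> = H.
Proof.
elim: b e A => [|x b IHb] [|k e] A; rewrite ?big_nil ?big_cons => defA;
  try by exists 1%G; rewrite ?big_nil // sub1G.
have [[_ B _ defB] defxB cxB tixB] := dprodP defA.
rewrite defB in defxB cxB tixB.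
have [H sHB ->] := IHb e B defB.
have sXx : <[x ^+ k]> \subset <[x]> by apply: cycleX.
exists (<[x ^+ k]> <*> H)%G => /=.
  by rewrite join_subG -defxB (subset_trans sXx (mulG_subl _ _))
    (subset_trans sHB (mulG_subr _ _)).
by rewrite dprodEY ?(subset_trans sHB) ?(subset_trans cxB) ?centS //;
  apply/trivgP; rewrite -tixB setISS.
Qed.

(** An abelian group of order (p ^ m) ^ n, rank at most n and exponent dividing
    p ^ m meets the bound on the order by the exponent to the power of the rank,
    so it is a direct product of n cyclic groups of order p ^ m.  Suitable powers
    of the generators of these factors generate a subgroup of any prescribed
    abelian type with at most n entries dividing p ^ m, and the abelian type
    determines an abelian group up to isomorphism. *)
Lemma abelian_embedding (gT rT : finGroupType) (p m n : nat)
    (A : {group gT}) (G : {group rT}) :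
  prime p -> (0 < m)%N -> (0 < n)%N ->
  abelian A -> (exponent A %| p ^ m)%N -> ('r(A) <= n)%N -> #|A| = (p ^ (m * n))%N ->
  abelian G -> (exponent G %| p ^ m)%N -> ('r(G) <= n)%N ->
  exists2 H : {group gT}, H \subset A & G \isog H.
Proof.
move=> p_pr m_gt0 n_gt0 cAA eA rA oA cGG eG rG.
have p_gt1 := prime_gt1 p_pr.
have [a leam ea] : exists2 a, (a <= m)%N & exponent A = (p ^ a)%N.
  by case/(dvdn_pfactor _ _ p_pr): eA => a; exists a.
have /leqifP := max_card_abelian cAA.
have le2 : (exponent A ^ 'r(A) <= #|A|)%N.
  by rewrite ea oA -expnM leq_exp2l // leq_mul.
case: ifP => [homA /eqP oA'|_]; last by rewrite ltnNge le2.
have [am rn] : a = m /\ 'r(A) = n.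
  move: oA'; rewrite oA ea -expnM => /eqP; rewrite eqn_exp2l // => /eqP e.
  have := leqif_mul (leqif_eq leam) (leqif_eq rA).
  by case=> _ ; rewrite -e eqxx muln_eq0 !eqn0Ngt m_gt0 n_gt0 /= =>
    /esym/andP[/eqP-> /eqP->].
have [b defA tyA] := abelian_structure cAA.
move: tyA; rewrite (abelian_type_homocyclic homA) rn ea am => tyA.
have [c defG tyG] := abelian_structure cGG.
have pG : p.-group G by rewrite -pnat_exponent (pnat_dvd eG) // pnatX pnat_id.
have pA : p.-group A by rewrite /pgroup oA pnatX pnat_id.
(* The power of a generator of order p ^ m that has order t is p ^ m / t; zipping
   with b keeps as many generators as the abelian type of G has entries. *)
pose e := [seq (p ^ m %/ t)%N | t <- abelian_type G].
have [H sHA defH] := bigdprod_cycleX e defA.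
exists H => //; rewrite eq_abelian_type_isog // ?(abelianS sHA) //.
have pH := pgroupS sHA pA.
have sz_e : (size e <= size b)%N.
  by rewrite size_map size_abelian_type // -(size_map order) tyA size_nseq.
have oz : [seq #[z.1 ^+ z.2] | z <- zip b e] = abelian_type G.
  have: all (fun t => t %| p ^ m)%N (abelian_type G).
    rewrite -tyG all_map; apply/allP => x c_x /=; apply: dvdn_trans eG.
    rewrite dvdn_exponent // -(bigdprodWY defG) mem_gen //.
    by have [c1 c2] := splitPr c_x; rewrite big_cat big_cons /= setUCA inE cycle_id.
  have: all (fun x => #[x] == p ^ m)%N b.
    by have := all_pred1_nseq (p ^ m)%N n; rewrite -tyA all_map.
  rewrite /e in sz_e *; elim: (abelian_type G) (b) sz_e => [|t ts IHt] [|x b'] //=.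
  rewrite ltnS => /IHt{}IHt /andP[/eqP ox /IHt{}IHt] /andP[dvt /IHt ->].
  have pm_gt0 : (0 < p ^ m)%N by rewrite expn_gt0 prime_gt0.
  have tgt0 : (0 < p ^ m %/ t)%N.
    by rewrite (divn_gt0 _ (dvdn_gt0 pm_gt0 dvt)) (dvdn_leq pm_gt0 dvt).
  have defpm := divnK dvt; congr (_ :: _).
  rewrite orderXdiv ox; last by rewrite -{2}defpm dvdn_mulr.
  by rewrite -{1}defpm mulKn.
have defH' : \big[dprod/1]_(x <- [seq z.1 ^+ z.2 | z <- zip b e]) <[x]> = H.
  by rewrite big_map.
have nt : 1 \notin [seq z.1 ^+ z.2 | z <- zip b e].
  have := abelian_type_gt1 G; rewrite -oz; apply: contraL => /mapP[z bz z1].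
  rewrite -has_predC has_map; apply/hasP; exists z => //=.
  by rewrite -z1 order1.
have := abelian_type_pgroup pH defH' nt; rewrite -map_comp [map _ _]oz => peq.
apply/eqP/esym; apply: (sorted_eq _ _ _ _ peq); try exact: abelian_type_sorted.
  by move=> ? ? ? /= h1 h2; apply: leq_trans h2 h1.
by move=> x y /andP[h1 h2]; apply/eqP; rewrite eqn_leq [(x <= y)%N]h2.
Qed.

End AbelianGroups.

(** * Componentwise Frobenius and its fixed points *)

Section Frobenius.
Variables (p : nat) (p_pr : prime p) (m n : nat).
Local Notation W := (witt p_pr m).

Lemma iter_Frobenius_rmorphism (R : comNzRingType) : p \in [pchar R] ->
  exists f : {rmorphism R -> R}, forall a, f a = a ^+ (p ^ n).
Proof.
move=> charR; elim: n => [|i [f fE]]; first by exists idfun.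
exists (f \o pFrobenius_aut charR) => a /=.
by rewrite fE pFrobenius_autE -exprM expnS.
Qed.

Lemma nth_wpow (R : comNzRingType) (x : W R) j :
  (wpow (p ^ n) x)`_j = x`_j ^+ (p ^ n).
Proof.
have [ltjm|lemj] := ltnP j m; first by rewrite (nth_map 0) ?size_tuple.
by rewrite !nth_default ?size_map ?size_tuple // expr0n gtn_eqF // expn_gt0 prime_gt0.
Qed.

Lemma wpowB (R : comNzRingType) (x y : W R) : p \in [pchar R] ->
  wpow (p ^ n) (x - y) = wpow (p ^ n) x - wpow (p ^ n) y.
Proof.
move=> /iter_Frobenius_rmorphism[f fE].
have wpowE (z : W R) : wpow (p ^ n) z = wmap f z.
  by apply: witt_ext => j _; rewrite nth_wpow nth_wmap fE.
by rewrite !wpowE wmapB.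
Qed.

Lemma wpow_wmap (R S : comNzRingType) (f : {rmorphism R -> S}) (x : W R) :
  wpow (p ^ n) (wmap f x) = wmap f (wpow (p ^ n) x).
Proof. by apply: witt_ext => j _; rewrite nth_wpow !nth_wmap nth_wpow rmorphXn. Qed.

Section FixedPoints.
Variables (Fq : finFieldType) (card_Fq : #|Fq| = (p ^ n)%N).

(** The polynomial X ^ q - X splits over the field with q elements, so it has no
    other root in an extension. *)
Lemma Frobenius_fixed (L : fieldType) (j : {rmorphism Fq -> L}) (a : L) :
  a ^+ (p ^ n) = a -> exists c, a = j c.
Proof.
move=> fix_a; have := congr1 (fun P => (map_poly j P).[a]) (finField_genPoly Fq).
rewrite /= rmorphB /= map_polyXn map_polyX !hornerE card_Fq fix_a subrr rmorph_prod.
rewrite horner_prod => /esym/eqP/prodf_eq0[c _].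
rewrite rmorphB /= map_polyX map_polyC /= !hornerE subr_eq0 => /eqP ->.
by exists c.
Qed.

Lemma wpow_fixed (L : fieldType) (j : {rmorphism Fq -> L}) (d : W L) :
  wpow (p ^ n) d = d -> exists c : W Fq, d = wmap j c.
Proof.
move=> fix_d; have fix_di (i : 'I_m) : exists c, d`_i = j c.
  by apply: Frobenius_fixed; rewrite -nth_wpow fix_d.
have [c dc] := fin_all_exists fix_di.
exists [tuple c i | i < m]; apply: witt_ext => i ltim; rewrite nth_wmap.
rewrite -(tnth_nth 0 [tuple c i | i < m] (Ordinal ltim)) tnth_mktuple.
exact: (dc (Ordinal ltim)).
Qed.

End FixedPoints.
End Frobenius.

(** * The additive group of Witt vectors over a finite field *)

Section FiniteWitt.
Variables (p : nat) (p_pr : prime p) (m n : nat) (m_gt0 : (0 < m)%N).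
Variables (Fq : finFieldType) (charFq : p \in [pchar Fq]).
Hypothesis (card_Fq : #|Fq| = (p ^ n)%N).
Local Notation W := (witt p_pr m Fq).

Lemma witt_expg (x : W) i : (x ^+ i)%g = x *+ i.
Proof. by elim: i => // i IH; rewrite expgS mulrS IH. Qed.

Lemma witt_abelian : abelian [set: W].
Proof. by apply/centsP => x _ y _; apply: waddC. Qed.

Lemma witt_exponent : (exponent [set: W] %| p ^ m)%N.
Proof. by apply/exponentP => x _; rewrite witt_expg wittMp_length. Qed.

Lemma card_witt : #|[set: W]| = (p ^ (m * n))%N.
Proof. by rewrite cardsT card_tuple card_Fq -expnM mulnC. Qed.

Lemma witt_pgroup : (p.-group [set: W])%g.
Proof. by rewrite /pgroup card_witt pnatX pnat_id. Qed.

(** The leading component x_i of a vector killed by p satisfies x_i ^ p = 0 as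
    long as there is a component of index i.+1, which limits the torsion to the
    last component. *)
Lemma witt_torsion_vanish (x : W) : x *+ p = 0 -> wvanish m.-1 x.
Proof.
move=> px0; suff H i : (i <= m.-1)%N -> wvanish i x by apply: H.
elim: i => // i IHi ltim; apply: vanishS; first by apply: IHi; apply: ltnW.
have ltim' : (i.+1 < m)%N by rewrite -(prednK m_gt0) ltnS.
have := nthMp_char charFq (IHi (ltnW ltim)) ltim'.
by rewrite px0 nth_wzero => /esym/eqP; rewrite expf_eq0 prime_gt0 // => /eqP.
Qed.

Lemma witt_rank : ('r([set: W])%g <= n)%N.
Proof.
apply: (rank_le_torsion p_pr witt_pgroup); rewrite -card_Fq.
have injm : {in 'Ldiv_p([set: W])%g &, injective (fun x : W => x`_m.-1)}.
  move=> x y; rewrite !inE !witt_expg => /eqP/witt_torsion_vanish xm.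
  move=> /eqP/witt_torsion_vanish ym exy; apply: witt_ext => j ltjm.
  have: (j <= m.-1)%N by rewrite -ltnS prednK.
  rewrite leq_eqVlt => /predU1P[-> //|{}ltjm].
  by rewrite xm ?ym.
by rewrite -(card_in_imset injm) max_card.
Qed.

End FiniteWitt.

(** * Finite splitting fields inside an algebraic closure *)

(** Membership in the image of F need not be decidable, whence the appeal to
    excluded middle to get an annihilating polynomial of least degree. *)
Lemma algebraic_irreducible (F : fieldType) (E : fieldType)
    (f : {rmorphism F -> E}) (z : E) :
  algebraicOver f z ->
  exists p : {poly F}, [/\ p != 0, root (map_poly f p) z & irreducible_poly p].
Proof.
case=> p nzp pz0.
suff [r [nzr rz0 minr]] : exists r : {poly F}, [/\ r != 0, root (map_poly f r) z &
    forall q : {poly F}, root (map_poly f q) z -> q != 0 -> (size r <= size q)%N].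
  by exists r; split=> //; apply/(subfx_irreducibleP rz0 nzr).
have [N leN] := ubnP (size p); elim: N p nzp pz0 leN => // N IHN p nzp pz0 leN.
have [[q [qz0 nzq ltqp]]|min_p] := classic (exists q : {poly F},
    [/\ root (map_poly f q) z, q != 0 & (size q < size p)%N]).
  by apply: (IHN q) => //; apply: leq_trans ltqp _.
exists p; split=> // q qz0 nzq; rewrite leqNgt; apply/negP => ltqp.
by apply: min_p; exists q.
Qed.

(** The extension is a tower of simple extensions, each one with its own base
    field; this is why the induction generalises the base. *)
Lemma algebraic_seq_extension (E : fieldType) (s : seq E) (F : fieldType)
    (f : {rmorphism F -> E}) :
  {in s, forall z, algebraicOver f z} ->
  exists (L : fieldExtType F) (g : {rmorphism L -> E}) (t : seq L),
    (forall a, g a%:A = f a) /\ map g t = s.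
Proof.
elim: s F f => [|z s IHs] F f alg_s.
  exists F^o, f, [::]; split=> // a; congr (f _); exact: mulr1.
have [r [nzr rz0 irr_r]] := algebraic_irreducible (alg_s z (mem_head z s)).
pose K : fieldExtType F := SubFieldExtType rz0 irr_r.
pose h : {rmorphism K -> E} := @subfx_inj _ _ f z r.
have hA a : h a%:A = f a by exact: subfx_inj_base.
have alg_h : {in s, forall y, algebraicOver h y}.
  move=> y s_y; have [|p nzp py0] := alg_s y; first by rewrite inE s_y orbT.
  exists (map_poly (in_alg K) p); first by rewrite map_poly_eq0.
  by rewrite -map_poly_comp (eq_map_poly hA).
have [L [g [t [gA gt]]]] := IHs K h alg_h.
exists (baseFieldType L), g, ((subfx_root f z r : K)%:A :: t).
split=> [a|]; last by rewrite /= gt gA [h _]subfx_inj_root.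
by rewrite baseField_scaleE gA hA.
Qed.

Definition splittingFieldOf (F : fieldType) (L : fieldExtType F)
    (splitL : SplittingField.axiom L) : splittingFieldType F :=
  HB.pack (FieldExt.sort L) (FieldExt_isSplittingField.Build F L splitL).

(** L is generated by all the roots in E of one polynomial that vanishes on s, so
    that it is normal. *)
Lemma algebraic_splitting_subfield (F : fieldType) (E : closedFieldType)
    (f : {rmorphism F -> E}) (s : seq E) :
  {in s, forall z, algebraicOver f z} ->
  exists (L : splittingFieldType F) (g : {rmorphism L -> E}) (t : seq L),
    (forall a, g a%:A = f a) /\ map g t = s.
Proof.
move=> alg_s.
have [p nzp ps0] : exists2 p : {poly F}, p != 0 & all (root (map_poly f p)) s.
  elim: s alg_s => [|z s IHs] alg_s; first by exists 1; rewrite ?oner_eq0.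
  have [p nzp pz0] := alg_s z (mem_head z s).
  have [|q nzq qs0] := IHs; first by move=> y s_y; apply: alg_s; rewrite inE s_y orbT.
  exists (p * q); first by rewrite mulf_neq0.
  rewrite /= rmorphM rootM pz0; apply/allP => y s_y.
  by rewrite rootM (allP qs0) ?orbT.
have [r Dp] := closed_field_poly_normal (map_poly f p).
have rE z : (z \in r) = root (map_poly f p) z.
  by rewrite Dp rootZ ?root_prod_XsubC // lead_coef_eq0 map_poly_eq0.
have [|L0 [g0 [t0 [g0A g0t]]]] := @algebraic_seq_extension E r F f.
  by move=> z; rewrite rE; exists p.
(* The tower may be larger than the field generated by the roots, which is the one
   that satisfies the splitting axiom. *)
pose L1 : fieldExtType F := subvs_of <<1 & t0>>.
pose toL := linfun (vsval : L1 -> L0).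
pose g1 : {rmorphism L1 -> E} := (g0 \o (vsval : L1 -> L0)).
have g1A a : g1 a%:A = f a.
  by rewrite -(g0A a); congr (g0 _); apply: (rmorph_alg (vsval : L1 -> L0)).
have [t1 Dt1]: {t1 | map toL t1 = t0}.
  exists (map (vsproj _) t0); rewrite -map_comp map_id_in // => y t_y.
  by rewrite /= lfunE /= vsprojK ?seqv_sub_adjoin.
have g1t : map g1 t1 = r.
  by rewrite -g0t -Dt1 -map_comp; apply: eq_map => u; rewrite /= lfunE.
have split1 : SplittingField.axiom L1.
  exists (map_poly (in_alg L1) p); first by apply/polyOver1P; exists p.
  exists t1.
    rewrite -(eqp_map g1) -map_poly_comp (eq_map_poly g1A) rmorph_prod Dp.
    rewrite -g1t big_map; apply: eqp_trans (eqp_scale _ _) _.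
      by rewrite lead_coef_eq0 map_poly_eq0.
    under eq_bigr do rewrite -[X in X - _](map_polyX g1) -(map_polyC g1) -rmorphB.
    exact: eqpxx.
  set Lt := LHS; pose Lt0 := (toL @: Lt)%VS; apply/vspaceP=> u.
  have: val u \in Lt0 by rewrite /Lt0 aimg_adjoin_seq aimg1 Dt1 (valP u).
  by case/memv_imgP=> v Lt_v; rewrite memvf lfunE => /val_inj->.
pose L := splittingFieldOf split1.
have t2 z : z \in s -> exists x : L, g1 x = z.
  move=> /(allP ps0); rewrite -rE -g1t => /mapP[x _ ->]; by exists x.
exists L, g1.
elim: s t2 {alg_s ps0} => [|z s IHs] t2; first by exists [::].
have [x xz] := t2 z (mem_head z s).
have [|t [_ gt]] := IHs; first by move=> y s_y; apply: t2; rewrite inE s_y orbT.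
by exists (x :: t); rewrite -xz -gt.
Qed.

(** * Witt vectors over a subfield *)

Section Subfield.
Variables (p : nat) (p_pr : prime p) (m : nat).
Variables (k : fieldType) (L : fieldExtType k) (K : {subfield L}).
Local Notation W := (witt p_pr m).
Implicit Types x y : W L.

Definition wover x := forall i, x`_i \in K.

Lemma wover_lift x : wover x ->
  exists x' : W (subvs_of K), x = wmap (vsval : subvs_of K -> L) x'.
Proof.
move=> Kx; exists (wmap (vsproj K) x); apply: witt_ext => i ltim.
by rewrite nth_wmap /= (nth_map 0) ?size_tuple // vsprojK.
Qed.

Lemma wover_wmap (x' : W (subvs_of K)) : wover (wmap (vsval : subvs_of K -> L) x').
Proof. by move=> i; rewrite nth_wmap; apply: subvsP. Qed.

Lemma woverD x y : wover x -> wover y -> wover (x + y).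
Proof.
by move=> /wover_lift[x' ->] /wover_lift[y' ->]; rewrite -wmapD; apply: wover_wmap.
Qed.

Lemma woverB x y : wover x -> wover y -> wover (x - y).
Proof.
by move=> /wover_lift[x' ->] /wover_lift[y' ->]; rewrite -wmapB; apply: wover_wmap.
Qed.

Lemma wover_alg (a : W k) : wover (wmap (in_alg L) a).
Proof. by move=> i; rewrite nth_wmap rpredZ ?mem1v. Qed.

Lemma wover_seq x : {subset (x : seq L) <= K} -> wover x.
Proof.
move=> sxK i; have [ltim|leim] := ltnP i m; first by rewrite sxK ?mem_nth ?size_tuple.
by rewrite nth_default ?size_tuple // mem0v.
Qed.

Lemma seq_wover x : wover x -> {subset (x : seq L) <= K}.
Proof. by move=> Kx a /(nthP 0)[i _ <-]. Qed.

End Subfield.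

(** * Artin-Schreier-Witt extensions *)

Section ArtinSchreierWitt.
Variables (p m n : nat) (p_pr : prime p) (m_gt0 : (0 < m)%N) (n_gt0 : (0 < n)%N).
Variables (k : fieldType) (char_k : p \in [pchar k]).
Variables (Fq : finFieldType) (card_Fq : #|Fq| = (p ^ n)%N).
Variables (inFq : {rmorphism Fq -> k}) (L : splittingFieldType k).
Local Notation W := (witt p_pr m).

Definition Fq_to : {rmorphism Fq -> L} := in_alg L \o inFq.
Local Notation j := Fq_to.

Let charL : p \in [pchar L]. Proof. by rewrite pchar_lalg. Qed.
Let charFq : p \in [pchar Fq]. Proof. by rewrite -(fmorph_pchar inFq). Qed.

Lemma wmap_alg_id (f : 'AEnd(L)) (a : W k) :
  wmap f (wmap (in_alg L) a) = wmap (in_alg L) a.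
Proof. by apply: witt_ext => i _; rewrite !nth_wmap /= rmorph_alg. Qed.

Lemma wmap_Fq_id (f : 'AEnd(L)) (c : W Fq) : wmap f (wmap j c) = wmap j c.
Proof. by apply: witt_ext => i _; rewrite !nth_wmap /= rmorph_alg. Qed.

Lemma wover_Fq (K : {subfield L}) (c : W Fq) : wover K (wmap j c).
Proof. by move=> i; rewrite nth_wmap rpredZ ?mem1v. Qed.

Lemma wmap_Fq_inj : injective (wmap j : W Fq -> W L).
Proof. exact/wmap_inj/fmorph_inj. Qed.

Lemma gal_fix_adjoin (x : W L) (K := <<1 & x>>%AS) (s : gal_of K) :
  wmap s x = x -> s = 1%g.
Proof.
move=> sx; apply/eqP/gal_eqP => a Ka; rewrite gal_id; apply/fixedSpaceP.
move: a Ka; apply/subvP/Fadjoin_seqP; split=> [|a /(nthP 0)[i _ <-]].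
  by apply/subvP => _ /vlineP[c ->]; apply/fixedSpaceP; rewrite rmorph_alg.
by apply/fixedSpaceP; rewrite -nth_wmap sx.
Qed.

Section Direct.
Variables (y : W L) (alpha : W k).
Hypothesis def_y : wpow (p ^ n) y - y = wmap (in_alg L) alpha.
Let K := <<1 & y>>%AS.

Let Ky : wover K y.
Proof. by apply: wover_seq => a y_a; apply: seqv_sub_adjoin. Qed.

(** The image f y is a root of the same equation, and the difference of two roots
    is fixed by the componentwise q-th power. *)
Lemma root_translate (f : 'AEnd(L)) : exists c : W Fq, wmap f y = y + wmap j c.
Proof.
have yq : wpow (p ^ n) y = wmap (in_alg L) alpha + y := canRL (subrK y) def_y.
have [|c dc] := @wpow_fixed p p_pr m n Fq card_Fq L j (wmap f y - y).
  by rewrite wpowB // wpow_wmap yq wmapD wmap_alg_id opprD addrACA subrr add0r.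
by exists c; rewrite -dc addrC subrK.
Qed.

(** An element is separable over a field of characteristic p as soon as it belongs
    to the extension generated by its q-th power.  By triangularity this holds
    for each component over the field generated by the previous ones. *)
Lemma separable_root : separable 1 K.
Proof.
pose M i : {subfield L} := <<1 & take i y>>%AS.
suff H i : (i <= m)%N -> separable 1 (M i).
  by have := H m (leqnn m); rewrite /M take_oversize ?size_tuple.
elim: i => [_|i IHi ltim]; first by rewrite /M take0 /= Fadjoin_nil separable_refl.
apply: (separable_trans (IHi (ltnW ltim))).
have -> : M i.+1 = <<M i; y`_i>>%AS.
  apply: val_inj => /=.
  by rewrite (take_nth 0) ?size_tuple // adjoin_rcons.
rewrite -adjoin_separable_eq (pcharf_p_separable _ _ n.-1 charL) prednK //.
have Mlow : wover (M i) (wlow i y).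
  move=> l; rewrite nth_wlow; case: ifP => [ltli|]; last by rewrite mem0v.
  apply: seqv_sub_adjoin; rewrite -(nth_take _ ltli).
  by rewrite mem_nth // size_take size_tuple ltim.
have Mlowa : wover (M i) (wlow i (wmap (in_alg L) alpha)).
  by move=> l; rewrite nth_wlow; case: ifP => _; rewrite ?mem0v ?wover_alg.
have dyi : y`_i = y`_i ^+ (p ^ n) -
    ((wlow i (wmap (in_alg L) alpha) + wlow i y)`_i + (wmap (in_alg L) alpha)`_i).
  have := congr1 (fun z : W L => z`_i) (canRL (subrK y) def_y).
  rewrite /= nth_wpow // nth_wadd => ->.
  by rewrite addrA [RHS]addrAC subrr add0r.
rewrite {1}dyi rpredB ?memv_adjoin // (subvP (subv_adjoin _ _)) // rpredD //.
  exact: woverD.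
exact: wover_alg.
Qed.

Lemma galois_root : galois 1 K.
Proof.
apply/and3P; split; [exact: sub1v | exact: separable_root |].
apply/forall_inP => f; rewrite inE kAutE => /andP[homf _].
rewrite -dimv_leqif_eq ?limg_dim_eq ?(eqP (AEnd_lker0 f)) ?capv0 //=.
rewrite aimg_adjoin_seq aimg1; apply/Fadjoin_seqP; split; first exact: sub1v.
have [c fy] := root_translate f.
have -> : map f y = wmap f y by [].
by rewrite fy; apply: seq_wover; apply: woverD => //; apply: wover_Fq.
Qed.

(** This is the natural map.  It is a morphism because the automorphisms fix the
    translations, and it is injective because y generates K. *)
Lemma gal_translation : exists phi : {morphism 'Gal(K / 1)%g >-> W Fq},
  ('injm phi)%g /\ forall s : gal_of K, wmap s y = y + wmap j (phi s).
Proof.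
have transl (s : gal_of K) : exists c : W Fq, wmap s y = y + wmap j c.
  exact: root_translate.
have [phi phiE] := fin_all_exists transl.
have phiM : {in 'Gal(K / 1)%g &, {morph phi : s t / (s * t)%g}}.
  move=> s t _ _; apply/wmap_Fq_inj/(addrI y); rewrite -phiE.
  have -> : wmap (s * t)%g y = wmap t (wmap s y).
    by apply: witt_ext => i _; rewrite !nth_wmap /= galM.
  by rewrite phiE wmapD wmap_Fq_id phiE -addrA -wmapD [_ + phi s]addrC.
exists (Morphism phiM); split=> //; apply/subsetP => s /morphpreP[_ /set1P phi_s].
have {}phi_s : phi s = 0 by [].
by apply/set1P/gal_fix_adjoin; rewrite phiE phi_s wmap0 addr0.
Qed.

Lemma root_abelian_extension :
  exists h l : nat, [/\ (h <= m)%N, (l <= n)%N & abelian_p_extension p h l K].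
Proof.
have [phi [injphi _]] := gal_translation.
set G := 'Gal(K / 1)%G.
have pH : (p.-group (phi @* G))%g := pgroupS (subsetT _) (witt_pgroup _ _ card_Fq).
have cH : abelian (phi @* G)%g := abelianS (subsetT _) (witt_abelian p_pr m Fq).
have pG : (p.-group G)%g by rewrite -(injm_pgroup injphi).
have cG : abelian G by rewrite -(injm_abelian injphi).
have eG : (exponent G %| p ^ m)%N.
  rewrite -(exponent_injm injphi) // (dvdn_trans (exponentS (subsetT _))) //.
  exact: witt_exponent.
have [h lehm eGh] : exists2 h, (h <= m)%N & exponent G = (p ^ h)%N.
  by case/(dvdn_pfactor _ _ p_pr): eG => h; exists h.
exists h, (size (abelian_type G)); split=> //.
  rewrite size_abelian_type // -(injm_rank injphi) //.
  by rewrite (leq_trans (rankS (subsetT _))) // (witt_rank p_pr m_gt0 charFq).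
by split=> //; apply: galois_root.
Qed.

End Direct.

Section Converse.
Variables (K : {subfield L}) (galK : galois 1 K).
Local Notation G := 'Gal(K / 1)%g.

(** Linear independence of characters. *)
Lemma galTrace_neq0 : exists2 z, z \in K & galTrace 1 K z != 0.
Proof.
have [||z Kz nz] := @gal_independent_contra _ _ K (mem G) (fun=> 1) 1%g.
- exact: group1.
- exact: oner_neq0.
exists z => //; congr (_ != 0): nz.
by apply: eq_bigr => s _; rewrite mul1r.
Qed.

Lemma additive_Hilbert90 (a : gal_of K -> L) :
  (forall s, s \in G -> a s \in K) ->
  {in G &, forall s t, a (s * t)%g = t (a s) + a t} ->
  exists2 b, b \in K & forall s, s \in G -> a s = s b - b.
Proof.
move=> Ka aM; have [z Kz] := galTrace_neq0; set T := galTrace 1 K z => nzT.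
have [c defT] : exists c, T = c%:A by apply/vlineP/mem_galTrace.
(* With b0 = \sum_s a_s (s z), reindexing and the cocycle relation give
   t b0 = b0 - a_t T; whence the sign and the division by T, which is fixed. *)
pose b0 := \sum_(s in G) a s * s z.
have Kb0 : b0 \in K by apply: rpred_sum => s Gs; rewrite rpredM ?Ka ?memv_gal.
exists (- (b0 / T)).
  rewrite rpredN rpred_div // defT rpredZ ?mem1v //.
move=> t Gt; have tT : t T = T by rewrite defT rmorph_alg.
suff tb0 : t b0 = b0 - a t * T.
  rewrite rmorphN fmorph_div /= tT tb0 opprK mulrBl opprB mulfK //.
  by rewrite subrK.
have reG (F : gal_of K -> L) : \sum_(s in G) F s = \sum_(s in G) F (s * t)%g.
  by rewrite (reindex_inj (mulIg t)); apply: eq_bigl => s; rewrite groupMr.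
rewrite rmorph_sum /T /galTrace mulr_sumr /b0 [X in _ = X - _]reG.
rewrite [X in _ = _ - X]reG -sumrB; apply: eq_bigr => s Gs.
by rewrite -mulrBl aM // addrK rmorphM /= galM.
Qed.

(** By induction on i, xi is a coboundary up to a cocycle c that vanishes below i.
    Its i-th component is then an additive cocycle, hence a coboundary s b - b,
    and adding to y the vector with b at index i and zeros elsewhere makes the
    component of index i of c vanish too. *)
Lemma witt_Hilbert90 (xi : gal_of K -> W Fq) :
  {in G &, forall s t, xi (s * t)%g = xi s + xi t} ->
  exists2 y : W L, wover K y & forall s, s \in G -> wmap s y = y + wmap j (xi s).
Proof.
move=> xiM.
pose c (y : W L) (s : gal_of K) := wmap j (xi s) - (wmap s y - y).
suff H i : exists2 y : W L, wover K y & forall s, s \in G -> wvanish i (c y s).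
  have [y Ky cy] := H m; exists y => // s Gs.
  have /eqP := vanish_all (cy s Gs).
  by rewrite subr_eq0 => /eqP ->; rewrite addrC subrK.
elim: i => [|i [y Ky cy]]; first by exists 0 => // i; rewrite nth_wzero mem0v.
have Kgal s (x : W L) : wover K x -> wover K (wmap (s : gal_of K) x).
  by move=> Kx l; rewrite nth_wmap /= memv_gal.
have cM : {in G &, forall s t, c y (s * t)%g = wmap t (c y s) + c y t}.
  move=> s t Gs Gt; rewrite /c xiM // !wmapD !wmapN wmapD wmapN wmap_Fq_id.
  have -> : wmap (s * t)%g y = wmap t (wmap s y).
    by apply: witt_ext => l _; rewrite !nth_wmap /= galM.
  by rewrite addrACA -opprD addrA subrK.
have [||b Kb ab] := @additive_Hilbert90 (fun s => (c y s)`_i).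
- by move=> s Gs; apply: woverB; [apply: wover_Fq | apply: woverB => //; apply: Kgal].
- move=> s t Gs Gt; rewrite cM // (nthD_vanish _ (cy t Gt)) //.
  by rewrite nth_wmap.
pose u : W L := [tuple (if l == i :> nat then b else 0) | l < m].
have nth_u l : (l < m)%N -> u`_l = if l == i then b else 0.
  by move=> ltlm; rewrite -(tnth_nth 0 u (Ordinal ltlm)) tnth_mktuple.
have Ku : wover K u.
  apply: wover_seq => a /(nthP 0)[l]; rewrite size_tuple => ltlm <-.
  by rewrite nth_u //; case: ifP => _ //; apply: mem0v.
have u_i : wvanish i u.
  move=> l ltli; have [ltlm|leml] := ltnP l m; last by rewrite nth_default ?size_tuple.
  by rewrite nth_u // ltn_eqF.
exists (y + u); first exact: woverD.
move=> s Gs.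
have su_i : wvanish i (wmap s u).
  by move=> l ltli; rewrite nth_wmap u_i ?rmorph0.
have du_i : wvanish i (- (wmap s u - u)) := vanishN (vanishD su_i (vanishN u_i)).
have -> : c (y + u) s = c y s + - (wmap s u - u).
  by rewrite /c wmapD [- (y + u)]opprD addrACA opprD addrA.
apply: vanishS; first exact: vanishD (cy s Gs) du_i.
have [ltim|leim] := ltnP i m; last by rewrite nth_default ?size_tuple.
rewrite (nthD_vanish _ du_i) // (vanish_nthN (vanishD su_i (vanishN u_i))) //.
rewrite (nthD_vanish _ (vanishN u_i)) // (vanish_nthN u_i) // nth_wmap nth_u // eqxx.
by rewrite ab // subrr.
Qed.

(** The vector y whose cocycle is an embedding of the Galois group is moved by
    every nontrivial automorphism, so that it generates K. *)
Lemma abelian_extension_root (cG : abelian G) (eG : (exponent G %| p ^ m)%N)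
    (rG : ('r(G)%g <= n)%N) :
  exists (y : W L) (alpha : W k),
    <<1 & y>>%VS = K :> {vspace L} /\ wpow (p ^ n) y - y = wmap (in_alg L) alpha.
Proof.
have [H _ isoGH] : exists2 H : {group W Fq}, H \subset [set: W Fq] & (G \isog H)%g.
  apply: (@abelian_embedding _ _ p m n [set: W Fq]%G 'Gal(K / 1)%G) => //.
  - exact: witt_abelian.
  - exact: witt_exponent.
  - exact: (witt_rank p_pr m_gt0 charFq).
  - exact: card_witt.
have /isogP[xi injxi _] := isoGH.
have [|y Ky sy] := @witt_Hilbert90 xi; first by move=> s t Gs Gt; apply: morphM.
(* F y - y is fixed since s changes y by a fixed point of F. *)
have beta_fix i : exists a : k, (wpow (p ^ n) y - y)`_i = a%:A.
  apply/vlineP; rewrite -[1%VS](galois_fixedField galK).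
  apply/fixedFieldP=> [|s Gs].
    by apply: woverB => // l; rewrite nth_wpow // rpredX.
  rewrite -nth_wmap wmapB -wpow_wmap // sy //; congr (_`_i).
  have -> : y + wmap j (xi s) = y - wmap j (- xi s) by rewrite wmapN opprK.
  rewrite wpowB //; have -> : wpow (p ^ n) (wmap j (- xi s)) = wmap j (- xi s).
    apply: witt_ext => l _; rewrite nth_wpow // nth_wmap -rmorphXn.
    by rewrite -card_Fq expf_card.
  by rewrite opprD addrACA subrr addr0.
have [a aE] := fin_all_exists (fun i : 'I_m => beta_fix i).
exists y, [tuple a i | i < m]; split; last first.
  apply: witt_ext => i ltim; rewrite (aE (Ordinal ltim)) nth_wmap.
  by rewrite -(tnth_nth 0 [tuple a i | i < m] (Ordinal ltim)) tnth_mktuple.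
pose M := <<1 & y>>%AS.
have sMK : (M <= K)%VS.
  by apply/Fadjoin_seqP; split; [apply: sub1v | apply: seq_wover].
have galMK : galois M K by apply: galoisS galK; rewrite sub1v.
apply/eqP; rewrite eqEsubv sMK /= -[X in (_ <= X)%VS](galois_fixedField galMK).
apply/subvP => x Kx; apply/fixedFieldP => // s galMs.
have Gs : s \in G by apply: subsetP galMs; apply: galS; apply: sub1v.
suff -> : s = 1%g by rewrite gal_id.
apply/eqP; rewrite -(morph_injm_eq1 injxi) //; apply/eqP.
apply/wmap_Fq_inj/(addrI y); rewrite -sy // wmap0 addr0.
apply: witt_ext => i ltim; rewrite nth_wmap /= (fixed_gal sMK galMs) //.
by apply: seqv_sub_adjoin; rewrite mem_nth ?size_tuple.
Qed.

End Converse.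
End ArtinSchreierWitt.

Theorem theorem8p5 (p m n : nat) (p_pr : prime p)
    (m_gt0 : (0 < m)%N) (n_gt0 : (0 < n)%N)
    (k : fieldType) (char_k : p \in [pchar k])
    (Fq : finFieldType) (card_Fq : #|Fq| = (p ^ n)%N)
    (inFq : {rmorphism Fq -> k})
    (kbar : closedFieldType) (ink : {rmorphism k -> kbar})
    (kbar_algebraic : forall z : kbar, algebraicOver ink z) :
  (forall (alpha : witt p_pr m k) (y0 : witt p_pr m kbar),
     wpow (p ^ n) y0 - y0 = wmap ink alpha ->
     exists (L : splittingFieldType k) (inL : {rmorphism L -> kbar})
            (y : witt p_pr m L),
       [/\ forall a : k, inL a%:A = ink a,
           wmap inL y = y0
         & let K := <<1 & y>>%VS in
           (exists h l : nat,
              [/\ (h <= m)%N, (l <= n)%N & abelian_p_extension p h l K]) /\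
           (exists (H : {group witt p_pr m Fq})
                   (phi : {morphism 'Gal(K / 1)%g >-> witt p_pr m Fq}),
              isom 'Gal(K / 1)%g H phi /\
              forall s : gal_of K, s \in 'Gal(K / 1)%g ->
                wmap s y = y + wmap (fun a => (inFq a)%:A) (phi s))])
  /\
  (forall (L : splittingFieldType k) (K : {subfield L}) (h l : nat),
     (h <= m)%N -> (l <= n)%N -> abelian_p_extension p h l K ->
     exists (y0 : witt p_pr m L) (alpha : witt p_pr m k),
       <<1 & y0>>%VS = K :> {vspace L} /\
       wpow (p ^ n) y0 - y0 = wmap (fun a => a%:A) alpha).
Proof.
split=> [alpha y0 def_y0|L K h l lehm leln [galK cG pG eG rG]].
  have [L [g [t [gA gt]]]] := algebraic_splitting_subfield
    (s := tval y0) (fun z _ => kbar_algebraic z).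
  have sz_t : size t == m by rewrite -(size_map g) gt size_tuple.
  pose y : witt p_pr m L := Tuple sz_t.
  have gy : wmap g y = y0 by apply: val_inj.
  (* g is injective, so the equation can be checked after applying it. *)
  have def_y : wpow (p ^ n) y - y = wmap (in_alg L) alpha.
    apply: (wmap_inj (fmorph_inj g)); rewrite wmapB -wpow_wmap gy def_y0.
    by apply: witt_ext => i _; rewrite !nth_wmap gA.
  exists L, g, y; split=> //; split.
    exact: (root_abelian_extension m_gt0 n_gt0 char_k card_Fq inFq def_y).
  have [phi [injphi phiE]] := gal_translation char_k card_Fq inFq def_y.
  exists (phi @* 'Gal(<<1 & y>>%VS / 1))%G, phi; split; last by move=> s _.
  exact/isomP.
have [||y [alpha [defK def_y]]] :=
    abelian_extension_root p_pr m_gt0 n_gt0 char_k card_Fq inFq galK cG.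
- by rewrite eG dvdn_exp2l.
- by rewrite -size_abelian_type // rG.
by exists y, alpha.
Qed.
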